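(* Let $\mathbf A\in\mathbb R^{m\times n}$ have an SVD with singular values $\sigma_1\ge\dots\ge\sigma_n\ge 0$, and let $p\ge 0$ and $k\ge 1$ be integers with $2\le p+k\le \ell$, where $\sigma_k>0$. Let $\mathbf\Omega\in\mathbb R^{n\times \ell}$ be any realization of the random (standard Gaussian) matrix such that $\mathbf\Omega_1=\mathbf V_1^T\mathbf\Omega$ has full row rank, and put $\mathbf\Omega_2=\mathbf V_2^T\mathbf\Omega$. Let $\hat{\mathbf A}_{\mathrm{SOR}}$ be computed from $\mathbf\Omega$ by the SOR-SVD algorithm. Then, for $\varrho\in\{2,F\}$, $$\|\mathbf A-\hat{\mathbf A}_{\mathrm{SOR}}\|_\varrho \le \|\mathbf A_0\|_\varrho + \sqrt{\frac{\alpha^2\|\mathbf\Omega_2\|_2^2\|\mathbf\Omega_1^\dagger\|_2^2}{1+\beta^2\|\mathbf\Omega_2\|_2^2\|\mathbf\Omega_1^\dagger\|_2^2}} + \sqrt{\frac{\eta^2\|\mathbf\Omega_2\|_2^2\|\mathbf\Omega_1^\dagger\|_2^2}{1+\tau^2\|\mathbf\Omega_2\|_2^2\|\mathbf\Omega_1^\dagger\|_2^2}},$$ where: (i) for the basic SOR-SVD algorithm, $\alpha=\sqrt k\,\frac{\sigma_{\ell-p+1}^2}{\sigma_k}$, $\beta=\frac{\sigma_{\ell-p+1}^2}{\sigma_1\sigma_k}$, $\eta=\sqrt k\,\sigma_{\ell-p+1}$, $\tau=\frac{\sigma_{\ell-p+1}}{\sigma_1}$; (ii) for the SOR-SVD algorithm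 with $q$ steps of the power method ($q\ge 0$ an integer), $\alpha=\sqrt k\,\frac{\sigma_{\ell-p+1}^2}{\sigma_k}\left(\frac{\sigma_{\ell-p+1}}{\sigma_k}\right)^{2q}$, $\beta=\frac{\sigma_{\ell-p+1}^2}{\sigma_1\sigma_k}\left(\frac{\sigma_{\ell-p+1}}{\sigma_k}\right)^{2q}$, $\eta=\sqrt k\,\sigma_{\ell-p+1}\left(\frac{\sigma_{\ell-p+1}}{\sigma_k}\right)^{2q}$, $\tau=\frac{\sigma_{\ell-p+1}}{\sigma_1}\left(\frac{\sigma_{\ell-p+1}}{\sigma_k}\right)^{2q}$.
   Context: Standing assumptions: $m\ge n>\max\{k,2\}$ and $k\le\ell<n$. $\|\cdot\|_2$ is the spectral norm, $\|\cdot\|_F$ the Frobenius norm; $\dagger$ is the Moore–Penrose pseudo-inverse. SVD: $\mathbf A=\mathbf U\mathbf\Sigma\mathbf V^T$ with $\mathbf U\in\mathbb R^{m\times n}$ having orthonormal columns, $\mathbf\Sigma=\mathrm{diag}(\sigma_1,\dots,\sigma_n)$, $\mathbf V\in\mathbb R^{n\times n}$ orthogonal. $\mathbf A_k$ is the rank-$k$ truncation of this SVD (keeping the $k$ leading singular triplets) and $\mathbf A_0=\mathbf A-\mathbf A_k$. Partition $\mathbf V=[\mathbf V_1\ \mathbf V_2]$ where $\mathbf V_1$ consists of the first $\ell-p$ columns and $\mathbf V_2$ of the remaining $n-\ell+p$ columns; thus $\mathbf\Omega_1=\mathbf V_1^T\mathbf\Omega\in\mathbb R^{(\ell-p)\times\ell}$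 and $\mathbf\Omega_2=\mathbf V_2^T\mathbf\Omega\in\mathbb R^{(n-\ell+p)\times\ell}$. SOR-SVD algorithm. Given $\mathbf A$, $k$, $\ell$ and $\mathbf\Omega\in\mathbb R^{n\times\ell}$ (drawn with i.i.d. standard Gaussian entries): in the basic form, set $\mathbf T_1=\mathbf A\mathbf\Omega$, $\mathbf T_2=\mathbf A^T\mathbf T_1$; with $q$ steps of the power method, set $\mathbf T_1=(\mathbf A\mathbf A^T)^q\mathbf A\mathbf\Omega$, $\mathbf T_2=\mathbf A^T\mathbf T_1=(\mathbf A^T\mathbf A)^{q+1}\mathbf\Omega$. Compute QR decompositions $\mathbf T_1=\mathbf Q_1\mathbf R_1$, $\mathbf T_2=\mathbf Q_2\mathbf R_2$ with $\mathbf Q_1\in\mathbb R^{m\times\ell}$, $\mathbf Q_2\in\mathbb R^{n\times\ell}$ having orthonormal columns; set $\mathbf M=\mathbf Q_1^T\mathbf A\mathbf Q_2\in\mathbb R^{\ell\times\ell}$; let $\mathbf M_k=\tilde{\mathbf U}_k\tilde{\mathbf\Sigma}_k\tilde{\mathbf V}_k^T$ be the rank-$k$ truncated SVD of $\mathbf M$. The output is $\hat{\mathbf A}_{\mathrm{SOR}}=(\mathbf Q_1\tilde{\mathbf U}_k)\tilde{\mathbf\Sigma}_k(\mathbf Q_2\tilde{\mathbf V}_k)^T=\mathbf Q_1\mathbf M_k\mathbf Q_2^T$. *)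

(* Defs.v *)
From mathcomp Require Import all_boot all_order all_algebra.
From mathcomp Require Import boolp classical_sets reals.

Set Implicit Arguments.
Unset Strict Implicit.
Unset Printing Implicit Defensive.

Import Order.TTheory GRing.Theory Num.Theory.
Local Open Scope ring_scope.

Definition frobenius_norm (R : realType) (m n : nat) (A : 'M[R]_(m, n)) : R :=
  Num.sqrt (\sum_(i < m) \sum_(j < n) A i j ^+ 2).

(* Operator norm induced by the Euclidean norm; on column vectors the Euclidean
   norm is [frobenius_norm]. The unit ball, not the unit sphere, is used so that
   the set is never empty. *)
Definition spectral_norm (R : realType) (m n : nat) (A : 'M[R]_(m, n)) : R :=
  sup [set y | exists2 x : 'cV[R]_n,
                 frobenius_norm x <= 1 & y = frobenius_norm (A *m x)].

Variant norm_kind := Spectral | Frobenius.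

Definition mxnorm (R : realType) (rho : norm_kind) (m n : nat)
    (A : 'M[R]_(m, n)) : R :=
  match rho with
  | Spectral => spectral_norm A
  | Frobenius => frobenius_norm A
  end.

Definition orthonormal_cols (R : realType) (m n : nat) (Q : 'M[R]_(m, n)) : Prop :=
  Q^T *m Q = 1%:M.

(* [s] is the diagonal of Sigma, in nonincreasing order; [V] is square, hence
   orthogonal. *)
Definition is_svd (R : realType) (m n : nat) (A : 'M[R]_(m, n))
    (U : 'M[R]_(m, n)) (s : 'rV[R]_n) (V : 'M[R]_n) : Prop :=
  [/\ orthonormal_cols U,
      orthonormal_cols V,
      (forall i : 'I_n, 0 <= s 0 i),
      (forall i j : 'I_n, (i <= j)%N -> s 0 j <= s 0 i) &
      A = U *m diag_mx s *m V^T].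

(* sigma_i with 1-based indexing, for 1 <= i <= n; it is 0 for i > n. *)
Definition sigma (R : realType) (n : nat) (s : 'rV[R]_n) (i : nat) : R :=
  oapp (fun j : 'I_n => s 0 j) 0 (insub i.-1).

Definition svd_trunc (R : realType) (k m n : nat)
    (U : 'M[R]_(m, n)) (s : 'rV[R]_n) (V : 'M[R]_n) : 'M[R]_(m, n) :=
  \sum_(i < n | (i < k)%N) s 0 i *: (col i U *m (col i V)^T).

Definition lead_cols (R : realType) (m n r : nat) (le_rn : (r <= n)%N)
    (V : 'M[R]_(m, n)) : 'M[R]_(m, r) :=
  colsub (widen_ord le_rn) V.

Lemma trail_ord_proof (n r : nat) (j : 'I_(n - r)) : (r + j < n)%N.
Proof. by rewrite -ltn_subRL. Qed.

Definition trail_cols (R : realType) (m n r : nat)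
    (V : 'M[R]_(m, n)) : 'M[R]_(m, n - r) :=
  colsub (fun j : 'I_(n - r) => Ordinal (trail_ord_proof j)) V.

(* The Penrose equations. Note that the library's [pinvmx] is only a partial
   inverse and does not satisfy the symmetry conditions. *)
Definition is_moore_penrose (R : realType) (m n : nat)
    (A : 'M[R]_(m, n)) (X : 'M[R]_(n, m)) : Prop :=
  [/\ A *m X *m A = A,
      X *m A *m X = X,
      (A *m X)^T = A *m X &
      (X *m A)^T = X *m A].

Definition moore_penrose (R : realType) (m n : nat) (A : 'M[R]_(m, n)) :
    'M[R]_(n, m) :=
  xget 0 [set X | is_moore_penrose A X].

Lemma gram_unitmx (R : realType) (m n : nat) (B : 'M[R]_(m, n)) :
  row_free B -> B *m B^T \in unitmx.
Proof.
move=> fB; rewrite -row_free_unit -kermx_eq0; apply/rowV0P => v /sub_kermxP vBB.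
apply: (row_free_inj fB); rewrite mul0mx.
have : (v *m B) *m (v *m B)^T = 0.
  by rewrite trmx_mul mulmxA -(mulmxA v) vBB mul0mx.
move/matrixP/(_ 0 0); rewrite mxE [RHS]mxE => /eqP.
rewrite psumr_eq0 => [/allP s0|j _]; last by rewrite [_^T _ _]mxE -expr2 sqr_ge0.
apply/rowP => j; have := s0 j (mem_index_enum j).
by rewrite [_^T _ _]mxE -expr2 sqrf_eq0 [RHS]mxE => /eqP.
Qed.

Lemma moore_penrose_fullrank (R : realType) (m n r : nat)
    (C : 'M[R]_(m, r)) (B : 'M[R]_(r, n)) :
  row_free C^T -> row_free B ->
  is_moore_penrose (C *m B)
    (B^T *m invmx (B *m B^T) *m invmx (C^T *m C) *m C^T).
Proof.
move=> fC fB; set G := B *m B^T; set H := C^T *m C.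
have uG : G \in unitmx by apply: gram_unitmx.
have uH : H \in unitmx by rewrite /H -{2}(trmxK C); apply: gram_unitmx.
have tG : G^T = G by rewrite trmx_mul trmxK.
have tH : H^T = H by rewrite trmx_mul trmxK.
set X := B^T *m _ *m _ *m _.
have AX : C *m B *m X = C *m invmx H *m C^T.
  by rewrite /X !mulmxA -(mulmxA C B B^T) -/G mulmxK.
have XA : X *m (C *m B) = B^T *m invmx G *m B.
  by rewrite /X !mulmxA -(mulmxA _ C^T C) -/H mulmxKV.
split.
- by rewrite AX !mulmxA -(mulmxA _ C^T C) -/H mulmxKV.
- by rewrite XA /X !mulmxA -(mulmxA _ B B^T) -/G mulmxKV.
- by rewrite AX !trmx_mul trmxK trmx_inv tH mulmxA.
- by rewrite XA !trmx_mul trmxK trmx_inv tG mulmxA.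
Qed.

Lemma moore_penroseP (R : realType) (m n : nat) (A : 'M[R]_(m, n)) :
  is_moore_penrose A (moore_penrose A).
Proof.
suff [X AX] : exists X, is_moore_penrose A X by exact: (xgetI 0 AX).
have fC : row_free (col_base A)^T.
  by rewrite /row_free mxrank_tr; exact: col_base_full.
have := moore_penrose_fullrank fC (row_base_free A).
by rewrite mulmx_base => AX; eexists; exact: AX.
Qed.

(* [is_trig_mx] means lower triangular, whence the transpose. *)
Definition is_qr (R : realType) (m l : nat) (T : 'M[R]_(m, l))
    (Q : 'M[R]_(m, l)) (S : 'M[R]_l) : Prop :=
  [/\ orthonormal_cols Q, is_trig_mx S^T & T = Q *m S].

(* The steps shared by the two versions of the algorithm. QR decompositions and
   SVDs need not be unique, so the output is specified by a relation: any valid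
   choice is an admissible run. *)
Definition sor_svd_from (R : realType) (k m n l : nat) (A : 'M[R]_(m, n))
    (T1 : 'M[R]_(m, l)) (T2 : 'M[R]_(n, l)) (Ahat : 'M[R]_(m, n)) : Prop :=
  exists (Q1 : 'M[R]_(m, l)) (S1 : 'M[R]_l) (Q2 : 'M[R]_(n, l)) (S2 : 'M[R]_l)
         (Ut : 'M[R]_l) (st : 'rV[R]_l) (Vt : 'M[R]_l),
    [/\ is_qr T1 Q1 S1,
        is_qr T2 Q2 S2,
        is_svd (Q1^T *m A *m Q2) Ut st Vt &
        Ahat = Q1 *m svd_trunc k Ut st Vt *m Q2^T].

Definition sor_svd (R : realType) (k m n l : nat) (A : 'M[R]_(m, n))
    (Omega : 'M[R]_(n, l)) (Ahat : 'M[R]_(m, n)) : Prop :=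
  let T1 := A *m Omega in
  let T2 := A^T *m T1 in
  sor_svd_from k A T1 T2 Ahat.

Definition sor_svd_power (R : realType) (q k m n l : nat) (A : 'M[R]_(m, n))
    (Omega : 'M[R]_(n, l)) (Ahat : 'M[R]_(m, n)) : Prop :=
  let T1 := (A *m A^T) ^+ q *m A *m Omega in
  let T2 := A^T *m T1 in
  sor_svd_from k A T1 T2 Ahat.

(* Main.v *)
(** The output is [Q1 M_k Q2^T] with [M = Q1^T A Q2], so by Eckart-Young in the
    Frobenius norm it is at least as close to [A] as [P1 A_k P2], where
    [P_i = Q_i Q_i^T]. Put [N_i = 1 - P_i]. Since [A0] and [A_k] have orthogonal
    row and column spaces, the inner product of [A0] with [A_k - P1 A_k P2] is
    minus that with [N1 A_k N2], and this is controlled by the fact that the norm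
    of [A0] is at most [sigma_j] for every [j <= k]. The result is
    [|A - Ahat|_F^2 <= |A0|_F^2 + sum_(j <= k) (sigma_j |N1 u_j| + sigma_j |N2 v_j|)^2].
    The spectral case follows because a near-optimal Frobenius error forces a
    near-optimal spectral error. Finally [sigma_j |N1 u_j|] is estimated by the
    distance from [sigma_j u_j] to one well-chosen vector in the range of [T1],
    a multiple of column [j] of [T1 Omega1^+], and similarly for [v_j] and [T2]. *)

Require Import Defs.
From mathcomp Require Import all_boot all_order all_algebra.
From mathcomp Require Import classical_sets reals.
From mathcomp Require Import ring lra zify.

Import Order.TTheory GRing.Theory Num.Theory.
Local Open Scope ring_scope.

(** * The Frobenius inner product and norm *)

Definition fdot {R : realType} {m n : nat} (X Y : 'M[R]_(m, n)) : R :=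
  \tr (X^T *m Y).

Section FrobeniusProduct.
Local Set Implicit Arguments.
Local Unset Strict Implicit.
Context {R : realType}.
Implicit Types m n r : nat.

Lemma fdotE m n (X Y : 'M[R]_(m, n)) :
  fdot X Y = \sum_i \sum_j X i j * Y i j.
Proof.
rewrite /fdot /mxtrace exchange_big; apply: eq_bigr => j _.
by rewrite mxE; apply: eq_bigr => i _; rewrite mxE.
Qed.

Lemma fdotC m n (X Y : 'M[R]_(m, n)) : fdot X Y = fdot Y X.
Proof. by rewrite /fdot -mxtrace_tr trmx_mul trmxK. Qed.

Lemma fdotDr m n (X Y Z : 'M[R]_(m, n)) : fdot X (Y + Z) = fdot X Y + fdot X Z.
Proof. by rewrite /fdot mulmxDr mxtraceD. Qed.

Lemma fdotZr m n a (X Y : 'M[R]_(m, n)) : fdot X (a *: Y) = a * fdot X Y.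
Proof. by rewrite /fdot -scalemxAr mxtraceZ. Qed.

Lemma fdotNr m n (X Y : 'M[R]_(m, n)) : fdot X (- Y) = - fdot X Y.
Proof. by rewrite -scaleN1r fdotZr mulN1r. Qed.

Lemma fdotBr m n (X Y Z : 'M[R]_(m, n)) : fdot X (Y - Z) = fdot X Y - fdot X Z.
Proof. by rewrite fdotDr fdotNr. Qed.

Lemma fdot0r m n (X : 'M[R]_(m, n)) : fdot X 0 = 0.
Proof. by rewrite /fdot mulmx0 mxtrace0. Qed.

Lemma fdot_sumr (I : finType) m n (X : 'M[R]_(m, n)) (F : I -> 'M[R]_(m, n)) :
  fdot X (\sum_i F i) = \sum_i fdot X (F i).
Proof. by rewrite /fdot mulmx_sumr raddf_sum. Qed.

Lemma fdot_mull m n r (X : 'M[R]_(m, n)) (B : 'M[R]_(m, r)) (Y : 'M[R]_(r, n)) :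
  fdot X (B *m Y) = fdot (B^T *m X) Y.
Proof. by rewrite /fdot trmx_mul trmxK mulmxA. Qed.

Lemma fdot_mulr m n r (X : 'M[R]_(m, n)) (Y : 'M[R]_(m, r)) (B : 'M[R]_(r, n)) :
  fdot X (Y *m B) = fdot (X *m B^T) Y.
Proof. by rewrite /fdot trmx_mul trmxK mulmxA mxtrace_mulC mulmxA. Qed.

Lemma fdot_ge0 m n (X : 'M[R]_(m, n)) : 0 <= fdot X X.
Proof.
by rewrite fdotE; do 2![apply: sumr_ge0 => ? _]; rewrite -expr2 sqr_ge0.
Qed.

Lemma sqr_frobenius m n (X : 'M[R]_(m, n)) : frobenius_norm X ^+ 2 = fdot X X.
Proof.
rewrite sqr_sqrtr ?fdotE; last by do 2![apply: sumr_ge0 => ? _]; rewrite sqr_ge0.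
by apply: eq_bigr => i _; apply: eq_bigr => j _; rewrite expr2.
Qed.

Lemma frobenius_ge0 m n (X : 'M[R]_(m, n)) : 0 <= frobenius_norm X.
Proof. exact: sqrtr_ge0. Qed.

Lemma frobenius_tr m n (X : 'M[R]_(m, n)) : frobenius_norm X^T = frobenius_norm X.
Proof.
by rewrite /frobenius_norm exchange_big; under eq_bigr do
  under eq_bigr do rewrite mxE.
Qed.

Lemma sqr_frobeniusD m n (X Y : 'M[R]_(m, n)) :
  frobenius_norm (X + Y) ^+ 2 =
  frobenius_norm X ^+ 2 + fdot X Y *+ 2 + frobenius_norm Y ^+ 2.
Proof.
by rewrite !sqr_frobenius fdotDr !(fdotC (X + Y)) !fdotDr (fdotC Y X); ring.
Qed.

Lemma frobeniusZ m n a (X : 'M[R]_(m, n)) :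
  frobenius_norm (a *: X) ^+ 2 = a ^+ 2 * frobenius_norm X ^+ 2.
Proof. by rewrite !sqr_frobenius fdotZr fdotC fdotZr mulrA. Qed.

Lemma frobeniusN m n (X : 'M[R]_(m, n)) : frobenius_norm (- X) = frobenius_norm X.
Proof.
by apply/eqP; rewrite -(eqrXn2 (ltn0Sn 1)) ?frobenius_ge0// -scaleN1r frobeniusZ
  sqrrN expr1n mul1r.
Qed.

(** Cauchy-Schwarz, from the nonnegativity of the squared norm of [c X - e Y]; in the nondegenerate
    case [c] and [e] are the norms of [Y] and [X]. *)
Lemma fdot_le m n (X Y : 'M[R]_(m, n)) :
  fdot X Y <= frobenius_norm X * frobenius_norm Y.
Proof.
set a := frobenius_norm X; set b := frobenius_norm Y.
have [a0 b0] : 0 <= a /\ 0 <= b by split; apply: frobenius_ge0.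
have key (c e : R) : 0 <= c ^+ 2 * a ^+ 2 - c * e * fdot X Y *+ 2 + e ^+ 2 * b ^+ 2.
  have := fdot_ge0 (c *: X - e *: Y).
  rewrite -sqr_frobenius sqr_frobeniusD frobeniusN !frobeniusZ fdotNr fdotZr.
  rewrite fdotC fdotZr (fdotC Y) => /le_trans; apply.
  by rewrite le_eqVlt; apply/orP; left; apply/eqP; rewrite -/a -/b; ring.
have [|f_gt0] := lerP (fdot X Y) 0; first by move/le_trans; apply; rewrite mulr_ge0.
have [a_gt0|] := ltrP 0 a; last first.
  move=> /(conj a0)/andP/le_anti a00.
  (* With [a = 0] this choice of [c] turns [key] into [0 <= b^2 - 2 (1 + b^2)], which is absurd. *)
  have := key ((1 + b ^+ 2) / fdot X Y) 1.
  by rewrite mulr1 -a00 divfK ?gt_eqF//; nra.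
have [b_gt0|] := ltrP 0 b; last first.
  move=> /(conj b0)/andP/le_anti b00.
  have := key 1 ((1 + a ^+ 2) / fdot X Y).
  by rewrite mul1r -b00 divfK ?gt_eqF//; nra.
have := key b a.
have ab : 0 < a * b by rewrite mulr_gt0.
rewrite -subr_ge0 => h; rewrite -subr_ge0 -(pmulr_rge0 _ ab); lra.
Qed.

Lemma frobenius_orthonormal m n r (Q : 'M[R]_(m, r)) (X : 'M[R]_(r, n)) :
  orthonormal_cols Q -> frobenius_norm (Q *m X) = frobenius_norm X.
Proof.
move=> QQ; apply/eqP; rewrite -(eqrXn2 (ltn0Sn 1)) ?frobenius_ge0//.
by rewrite !sqr_frobenius fdot_mull mulmxA QQ mul1mx.
Qed.

Lemma frobenius_orthonormal_tr m n r (Q : 'M[R]_(n, r)) (X : 'M[R]_(m, r)) :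
  orthonormal_cols Q -> frobenius_norm (X *m Q^T) = frobenius_norm X.
Proof.
by move=> QQ; rewrite -frobenius_tr trmx_mul trmxK frobenius_orthonormal// frobenius_tr.
Qed.

Lemma sqr_frobenius_col m n (X : 'M[R]_(m, n)) :
  frobenius_norm X ^+ 2 = \sum_j frobenius_norm (col j X) ^+ 2.
Proof.
rewrite sqr_frobenius fdotE exchange_big; apply: eq_bigr => j _.
rewrite sqr_frobenius fdotE; apply: eq_bigr => i _.
by rewrite big_ord1 !mxE.
Qed.

Lemma sqr_frobenius_cV n (x : 'cV[R]_n) :
  frobenius_norm x ^+ 2 = \sum_i x i 0 ^+ 2.
Proof.
by rewrite sqr_frobenius fdotE; apply: eq_bigr => i _; rewrite big_ord1 expr2.
Qed.

(** Cauchy-Schwarz row by row. This crude estimate shows that the set whose supremum defines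
    [spectral_norm] is bounded above. *)
Lemma frobenius_mul_cV m n (A : 'M[R]_(m, n)) (x : 'cV[R]_n) :
  frobenius_norm (A *m x) <= frobenius_norm A * frobenius_norm x.
Proof.
rewrite -ler_sqr ?nnegrE ?mulr_ge0 ?frobenius_ge0//.
rewrite sqr_frobenius_cV exprMn -(frobenius_tr A) (sqr_frobenius_col A^T).
rewrite mulr_suml; apply: ler_sum => i _; rewrite -exprMn.
have -> : (A *m x) i 0 = fdot (col i A^T) x.
  by rewrite fdotE mxE; apply: eq_bigr => j _; rewrite big_ord1 !mxE.
rewrite -real_normK ?num_real// ler_sqr ?nnegrE ?mulr_ge0 ?frobenius_ge0//.
rewrite ler_norml fdot_le andbT lerNl.
by rewrite -fdotNr -(frobeniusN x) fdot_le.
Qed.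

End FrobeniusProduct.

(** * The spectral norm as an operator norm *)

Section SpectralNorm.
Local Set Implicit Arguments.
Local Unset Strict Implicit.
Context {R : realType}.
Implicit Types m n : nat.

Lemma frobenius0 m n : frobenius_norm (0 : 'M[R]_(m, n)) = 0.
Proof. by apply/eqP; rewrite -sqrf_eq0 sqr_frobenius fdot0r. Qed.

Lemma spectral_norm_ub m n (A : 'M[R]_(m, n)) (x : 'cV[R]_n) :
  frobenius_norm x <= 1 -> frobenius_norm (A *m x) <= spectral_norm A.
Proof.
move=> x1; apply: ub_le_sup; last by exists x.
exists (frobenius_norm A) => _ [y y1 ->].
by apply: le_trans (frobenius_mul_cV _ _) _; rewrite ler_piMr// frobenius_ge0.
Qed.

Lemma spectral_norm_le m n (A : 'M[R]_(m, n)) (c : R) :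
  (forall x : 'cV_n, frobenius_norm x <= 1 -> frobenius_norm (A *m x) <= c) ->
  spectral_norm A <= c.
Proof.
move=> Ac; apply: ge_sup => [|_ [x x1 ->]]; last exact: Ac.
by exists (frobenius_norm (A *m (0 : 'cV_n))), 0; rewrite ?frobenius0.
Qed.

Lemma spectral_norm_ge0 m n (A : 'M[R]_(m, n)) : 0 <= spectral_norm A.
Proof.
have := @spectral_norm_ub _ _ A 0.
by rewrite mulmx0 !frobenius0; apply.
Qed.

Lemma spectral_norm_mul m n (A : 'M[R]_(m, n)) (x : 'cV[R]_n) :
  frobenius_norm (A *m x) ^+ 2 <= spectral_norm A ^+ 2 * frobenius_norm x ^+ 2.
Proof.
have [x0|x0] := eqVneq (frobenius_norm x) 0.
  have := frobenius_mul_cV A x; rewrite x0 mulr0 => Ax0.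
  have /le_anti/esym -> : 0 <= frobenius_norm (A *m x) <= 0.
    by rewrite frobenius_ge0.
  by rewrite expr0n mulr0.
have x_gt0 : 0 < frobenius_norm x by rewrite lt_def x0 frobenius_ge0.
have n1 : frobenius_norm ((frobenius_norm x)^-1 *: x) ^+ 2 = 1.
  by rewrite frobeniusZ -exprMn mulVf ?expr1n.
have : frobenius_norm (A *m ((frobenius_norm x)^-1 *: x)) <= spectral_norm A.
  by apply: spectral_norm_ub; rewrite -ler_sqr ?nnegrE ?frobenius_ge0// n1 expr1n.
rewrite -ler_sqr ?nnegrE ?frobenius_ge0 ?spectral_norm_ge0//.
by rewrite -scalemxAr frobeniusZ exprVn mulrC ler_pdivrMr// exprn_gt0.
Qed.

End SpectralNorm.

(** * Orthogonal projections and distance to a range *)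

Section Projections.
Local Set Implicit Arguments.
Local Unset Strict Implicit.
Context {R : realType}.
Implicit Types m n l : nat.

(** Pythagoras: a symmetric idempotent [P] satisfies [P^T (1 - P) = 0], so the cross term
    vanishes. *)
Lemma sqr_frobenius_proj m n (P : 'M[R]_m) (X : 'M[R]_(m, n)) :
  P^T = P -> P *m P = P ->
  frobenius_norm X ^+ 2 =
    frobenius_norm (P *m X) ^+ 2 + frobenius_norm ((1%:M - P) *m X) ^+ 2.
Proof.
move=> PT PP.
have {1}-> : X = P *m X + (1%:M - P) *m X by rewrite -mulmxDl addrC subrK mul1mx.
rewrite sqr_frobeniusD fdot_mull raddfB /= trmx1 PT mulmxA mulmxBl mul1mx PP.
by rewrite subrr mul0mx fdotC fdot0r mul0rn addr0.
Qed.

Lemma frobenius_proj_le m n (P : 'M[R]_m) (X : 'M[R]_(m, n)) :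
  P^T = P -> P *m P = P ->
  frobenius_norm (P *m X) ^+ 2 <= frobenius_norm X ^+ 2.
Proof. by move=> PT PP; rewrite (sqr_frobenius_proj X PT PP) lerDl sqr_ge0. Qed.

Lemma compl_proj_tr m (P : 'M[R]_m) : P^T = P -> (1%:M - P)^T = 1%:M - P.
Proof. by move=> PT; rewrite raddfB /= trmx1 PT. Qed.

Lemma compl_proj_idem m (P : 'M[R]_m) :
  P *m P = P -> (1%:M - P) *m (1%:M - P) = 1%:M - P.
Proof. by move=> PP; rewrite mulmxBl mul1mx mulmxBr mulmx1 PP subrr subr0. Qed.

(** When [Q] has orthonormal columns, this is the orthogonal projection onto the complement of the
    range of [Q]. *)
Definition coproj m l (Q : 'M[R]_(m, l)) : 'M[R]_m := 1%:M - Q *m Q^T.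

Lemma rangeproj_tr m l (Q : 'M[R]_(m, l)) : (Q *m Q^T)^T = Q *m Q^T.
Proof. by rewrite trmx_mul trmxK. Qed.

Lemma rangeproj_idem m l (Q : 'M[R]_(m, l)) :
  orthonormal_cols Q -> Q *m Q^T *m (Q *m Q^T) = Q *m Q^T.
Proof. by move=> QQ; rewrite mulmxA -[Q *m _ *m Q]mulmxA QQ mulmx1. Qed.

Lemma coproj_tr m l (Q : 'M[R]_(m, l)) : (coproj Q)^T = coproj Q.
Proof. exact/compl_proj_tr/rangeproj_tr. Qed.

Lemma coproj_idem m l (Q : 'M[R]_(m, l)) :
  orthonormal_cols Q -> coproj Q *m coproj Q = coproj Q.
Proof. by move=> QQ; apply/compl_proj_idem/rangeproj_idem. Qed.

(** [coproj Q] kills [Q z], and a projection does not increase the norm. So any single vector [Q z]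
    of the range gives an upper bound. *)
Lemma coproj_dist m l (Q : 'M[R]_(m, l)) (y : 'cV[R]_m) (z : 'cV[R]_l) :
  orthonormal_cols Q ->
  frobenius_norm (coproj Q *m y) ^+ 2 <= frobenius_norm (y - Q *m z) ^+ 2.
Proof.
move=> QQ.
have QN : coproj Q *m Q = 0.
  by rewrite mulmxBl mul1mx -mulmxA QQ mulmx1 subrr.
have -> : coproj Q *m y = coproj Q *m (y - Q *m z).
  by rewrite mulmxBr (mulmxA _ Q) QN mul0mx subr0.
exact: frobenius_proj_le (coproj_tr _) (coproj_idem QQ).
Qed.

End Projections.

(** * Truncations and tails of an SVD *)

Section SingularValues.
Local Set Implicit Arguments.
Local Unset Strict Implicit.
Context {R : realType}.
Implicit Types m n k r : nat.

Lemma mulmx_diag_sum m n r (U : 'M[R]_(m, r)) (d : 'rV[R]_r) (V : 'M[R]_(n, r)) :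
  U *m diag_mx d *m V^T = \sum_i d 0 i *: (col i U *m (col i V)^T).
Proof.
apply/matrixP => a b; rewrite mul_mx_diag mxE summxE; apply: eq_bigr => i _.
by rewrite !mxE big_ord1 !mxE mulrA [d 0 i * _]mulrC.
Qed.

Lemma frobenius_mul_diag m n (X : 'M[R]_(m, n)) (d : 'rV[R]_n) :
  frobenius_norm (X *m diag_mx d) ^+ 2 =
    \sum_j d 0 j ^+ 2 * frobenius_norm (col j X) ^+ 2.
Proof.
rewrite sqr_frobenius_col; apply: eq_bigr => j _; rewrite -frobeniusZ.
by congr (frobenius_norm _ ^+ 2); apply/colP => i; rewrite mul_mx_diag !mxE mulrC.
Qed.

Lemma frobenius_diag m n r (U : 'M[R]_(m, r)) (d : 'rV[R]_r) (V : 'M[R]_(n, r)) :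
  orthonormal_cols U -> orthonormal_cols V ->
  frobenius_norm (U *m diag_mx d *m V^T) ^+ 2 = \sum_i d 0 i ^+ 2.
Proof.
move=> UU VV; rewrite frobenius_orthonormal_tr// frobenius_orthonormal//.
rewrite sqr_frobenius_col; apply: eq_bigr => i _.
rewrite sqr_frobenius_cV (bigD1 i)//= big1 ?addr0 => [|j ji].
  by rewrite !mxE eqxx.
by rewrite !mxE (negPf ji) expr0n.
Qed.

(** Entries are zeroed rather than dropped, so that a truncation and its tail keep the same factors
    [U] and [V] as the full SVD. *)
Definition lead_row n k (d : 'rV[R]_n) : 'rV[R]_n :=
  \row_i (if (i < k)%N then d 0 i else 0).
Definition tail_row n k (d : 'rV[R]_n) : 'rV[R]_n :=
  \row_i (if (k <= i)%N then d 0 i else 0).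

Lemma svd_truncE k m n (U : 'M[R]_(m, n)) (d : 'rV[R]_n) (V : 'M[R]_n) :
  svd_trunc k U d V = U *m diag_mx (lead_row k d) *m V^T.
Proof.
rewrite mulmx_diag_sum /svd_trunc [LHS]big_mkcond /=; apply: eq_bigr => i _.
by rewrite mxE; case: ifP => _; rewrite ?scale0r.
Qed.

Lemma svd_tailE k m n (U : 'M[R]_(m, n)) (d : 'rV[R]_n) (V : 'M[R]_n) :
  U *m diag_mx d *m V^T - svd_trunc k U d V = U *m diag_mx (tail_row k d) *m V^T.
Proof.
rewrite svd_truncE -mulmxBl -mulmxBr -raddfB /=; congr (_ *m diag_mx _ *m _).
by apply/rowP => i; rewrite !mxE ltnNge; case: leqP; rewrite ?subr0 ?subrr.
Qed.

Lemma frobenius_svd_tail k m n (A : 'M[R]_(m, n)) U d V :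
  is_svd A U d V ->
  frobenius_norm (A - svd_trunc k U d V) ^+ 2 =
    \sum_(i < n | (k <= i)%N) d 0 i ^+ 2.
Proof.
case=> UU VV _ _ ->; rewrite svd_tailE frobenius_diag// [RHS]big_mkcond.
by apply: eq_bigr => i _; rewrite mxE; case: ifP => _; rewrite ?expr0n.
Qed.

Lemma sum_leq_ord n r : (\sum_(i < n) (r <= i) = n - r)%N.
Proof.
elim: n => [|n IH]; first by rewrite big_ord0.
by rewrite big_ord_recr /= IH; case: leqP; lia.
Qed.

Lemma sum_ltn_ord n k : (\sum_(i < n | (i < k)%N) 1 <= k)%N.
Proof.
elim: n => [|n IH]; first by rewrite big_ord0.
have [nk|kn] := ltnP n k.
  apply: (@leq_trans n.+1) => //.
  by rewrite -[leqRHS]card_ord -sum1_card [leqLHS]big_mkcond leq_sum// => i; case: ifP.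
by rewrite big_mkcond big_ord_recr /= -big_mkcond/= ltnNge kn addn0.
Qed.

Lemma mxrank_svd_trunc k m n (U : 'M[R]_(m, n)) (d : 'rV[R]_n) (V : 'M[R]_n) :
  (\rank (svd_trunc k U d V) <= k)%N.
Proof.
apply: (@leq_trans (\sum_(i < n | (i < k)%N) 1)%N).
  rewrite /svd_trunc; elim/big_ind2: _ => [|A a B b lA lB|i _].
  - by rewrite mxrank0.
  - by apply: leq_trans (mxrank_add _ _) _; apply: leq_add.
  apply: leq_trans (mxrank_scale _ _) _.
  by apply: leq_trans (mxrankM_maxl _ _) _; apply: rank_leq_col.
exact: sum_ltn_ord.
Qed.

End SingularValues.

(** * The Eckart-Young lower bound in the Frobenius norm *)

Section EckartYoung.
Local Set Implicit Arguments.
Local Unset Strict Implicit.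
Context {R : realType}.
Implicit Types m n k r : nat.

(** For a basis [D] of the row space, [D D^T] is invertible and [P = D^T (D D^T)^-1 D]. By
    cyclicity, its trace is that of an identity of size [\rank B]. *)
Lemma rowspace_proj m n (B : 'M[R]_(m, n)) :
  exists P : 'M[R]_n, [/\ P^T = P, P *m P = P, B *m P = B &
    \tr P = (\rank B)%:R].
Proof.
move: (row_base B) (gram_unitmx (row_base_free B)) (mulmx_base B) => D.
set G := D *m D^T => uG defB; have GT : G^T = G by rewrite trmx_mul trmxK.
have DP : D *m (D^T *m invmx G *m D) = D by rewrite !mulmxA mulmxV// mul1mx.
exists (D^T *m invmx G *m D); split.
- by rewrite !trmx_mul trmxK trmx_inv GT mulmxA.
- by rewrite -[LHS]mulmxA DP.
- by rewrite -[X in X *m _]defB -[LHS]mulmxA DP.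
- by rewrite -mulmxA mxtrace_mulC -mulmxA mulVmx// mxtrace1.
Qed.

Lemma frobenius_col_orthonormal m n (U : 'M[R]_(m, n)) j :
  orthonormal_cols U -> frobenius_norm (col j U) ^+ 2 = 1.
Proof.
move=> UU; rewrite colE frobenius_orthonormal// sqr_frobenius_cV.
rewrite (bigD1 j)//= big1 ?addr0 => [|i ij]; first by rewrite mxE !eqxx expr1n.
by rewrite mxE (negPf ij) expr0n.
Qed.

(** With [N] the projection onto the complement of the row space of [B], [(A - B) N = A N], whose
    squared norm is the sum of [s_i^2 c_i] with weights [c_i = |N v_i|^2] in [[0, 1]]. The weights
    add up to [tr N >= n - r], so the sum is least when they sit on the smallest singular values. *)
Lemma eckart_young m n r (A B : 'M[R]_(m, n)) U s V :
  is_svd A U s V -> (\rank B <= r)%N ->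
  \sum_(i < n | (r <= i)%N) s 0 i ^+ 2 <= frobenius_norm (A - B) ^+ 2.
Proof.
case=> UU VV s_ge0 s_noninc AE rB.
have [P [PT PP BP trP]] := rowspace_proj B.
have NT := compl_proj_tr PT; have NN := compl_proj_idem PP.
set N := 1%:M - P in NT NN.
apply: (@le_trans _ _ (frobenius_norm (A *m N) ^+ 2)); last first.
  have -> : A *m N = (A - B) *m N.
    by rewrite mulmxBl [B *m N]mulmxBr BP mulmx1 subrr subr0.
  rewrite -frobenius_tr -[leRHS](congr1 (fun x => x ^+ 2) (frobenius_tr _)).
  by rewrite trmx_mul NT frobenius_proj_le.
pose c i := frobenius_norm (N *m col i V) ^+ 2.
have c_ge0 i : 0 <= c i by apply: sqr_ge0.
have c_le1 i : c i <= 1.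
  by rewrite -(frobenius_col_orthonormal i VV) frobenius_proj_le.
have sum_c : \sum_i c i = n%:R - (\rank B)%:R.
  under eq_bigr => i _ do rewrite /c colE mulmxA -colE.
  rewrite -sqr_frobenius_col -[N *m V]trmxK frobenius_tr trmx_mul NT.
  rewrite sqr_frobenius fdot_mull trmxK mulmxA (mulmx1C VV) mul1mx /fdot NT NN.
  by rewrite raddfB /= mxtrace1 trP.
have -> : frobenius_norm (A *m N) ^+ 2 = \sum_i s 0 i ^+ 2 * c i.
  rewrite AE -!mulmxA frobenius_orthonormal// -frobenius_tr !trmx_mul trmxK NT.
  rewrite tr_diag_mx frobenius_mul_diag; apply: eq_bigr => i _.
  by rewrite /c !colE mulmxA.
(* For [n <= r] no singular value has index [r], but then the left-hand sum is empty. *)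
have [nr|rn] := leqP n r.
  rewrite big1 ?sumr_ge0// => [i _|i ri]; first by rewrite mulr_ge0// sqr_ge0.
  by have := ltn_ord i; rewrite ltnNge (leq_trans nr ri).
(* The threshold [t] separates the two ranges: [s_i^2 >= t] where the weight excess [c_i - [r <= i]]
   is nonnegative, and [s_i^2 <= t] where it is nonpositive. *)
pose t := s 0 (Ordinal rn) ^+ 2.
rewrite big_mkcond /= -subr_ge0 -sumrB.
apply: (@le_trans _ _ (\sum_i (t * (c i - (r <= i)%:R)))).
  rewrite -mulr_sumr mulr_ge0 ?sqr_ge0// sumrB sum_c -natr_sum sum_leq_ord.
  by rewrite natrB 1?ltnW// opprB addrC addrA subrK subr_ge0 ler_nat.
apply: ler_sum => i _; case: leqP => ri.
  have : s 0 i ^+ 2 <= t by rewrite ler_sqr ?nnegrE ?s_ge0// s_noninc.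
  by have := c_le1 i; rewrite /=; nra.
have : t <= s 0 i ^+ 2 by rewrite ler_sqr ?nnegrE ?s_ge0// s_noninc// ltnW.
by have := c_ge0 i; rewrite /=; nra.
Qed.

End EckartYoung.

(** * Distance from scaled singular vectors to the range of a sketch *)

Section ColumnBound.
Local Set Implicit Arguments.
Local Unset Strict Implicit.
Context {R : realType}.
Implicit Types a n l k r e : nat.

Lemma sum_trail n r (F : 'I_n -> R) :
  \sum_(i < n | (r <= i)%N) F i =
  \sum_(i < n - r) F (Ordinal (trail_ord_proof i)).
Proof.
rewrite (reindex_omap (fun i : 'I_(n - r) => Ordinal (trail_ord_proof i))
  (fun i => insub (i - r)%N)) => [|i ri].
  by apply: eq_bigl => i; rewrite /= leq_addr addKn valK eqxx.
rewrite insubT /=; last by move=> h; congr Some; apply/val_inj => /=; lia.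
by have := ltn_ord i; lia.
Qed.

(** Stated for a general [W] and exponent, so as to cover both [T1] ([W = U]) and [T2] ([W = V]).
    The distance from [s_j w_j] to the range of [Q] is bounded by testing one multiple of column [j]
    of [T X], where [T = Q S] is the sketch. *)
Lemma subspace_col_bound a n l k r e (rn : (r <= n)%N)
    (W : 'M[R]_(a, n)) (V : 'M[R]_n) (s : 'rV[R]_n) (Om : 'M[R]_(n, l))
    (Q : 'M[R]_(a, l)) (S : 'M[R]_l) (X : 'M[R]_(l, r)) (s1 sk sl : R) :
  orthonormal_cols W -> orthonormal_cols Q ->
  (forall i, 0 <= s 0 i <= s1) ->
  0 < sk -> (forall i : 'I_n, (i < k)%N -> sk <= s 0 i) ->
  (forall i : 'I_n, (r <= i)%N -> s 0 i <= sl) ->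
  (k <= r)%N -> 0 <= sl ->
  (lead_cols rn V)^T *m Om *m X = 1%:M ->
  W *m diag_mx (\row_i s 0 i ^+ e.+1) *m V^T *m Om = Q *m S ->
  let w := spectral_norm ((trail_cols r V)^T *m Om) in
  let g := sl ^+ e.+1 / sk ^+ e * w * spectral_norm X in
  forall j : 'I_n, (j < k)%N ->
  s 0 j ^+ 2 * frobenius_norm (coproj Q *m col j W) ^+ 2 <=
  g ^+ 2 / (1 + (g / s1) ^+ 2).
Proof.
move=> WW QQ s_bnd sk_gt0 s_lead s_trail kr sl_ge0 OmX TQ w g j jk.
have jr := leq_trans jk kr; pose j' := Ordinal jr.
have sj_gt0 : 0 < s 0 j by apply: lt_le_trans (s_lead _ jk).
have s1_gt0 : 0 < s1 by apply: lt_le_trans sj_gt0 _; case/andP: (s_bnd j).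
(* This [t] minimises [s1^2 (1 - t)^2 + g^2 t^2]. *)
pose t := s1 ^+ 2 / (s1 ^+ 2 + g ^+ 2).
(* Since [X] is a right inverse of [V1^T Om], the first [r] entries of [c] are those of the [j]-th
   unit vector; only the trailing ones need an estimate. *)
pose c := V^T *m Om *m col j' X.
have c_lead (i : 'I_n) : (i < r)%N -> c i 0 = (i == j)%:R.
  move=> ir; pose i' := Ordinal ir.
  have := congr1 (fun M : 'M_r => M i' j') OmX.
  rewrite /lead_cols trmx_mxsub !mul_rowsub_mx /c colE mulmxA -colE.
  rewrite !mxE /= => h; rewrite -[RHS]h; apply: eq_bigr => b _; rewrite !mxE.
  congr (_ * _); apply: eq_bigr => ? _; rewrite !mxE.
  by congr (V _ _ * _); apply: val_inj.
have c_trail : \sum_(i < n | (r <= i)%N) c i 0 ^+ 2 <= w ^+ 2 * spectral_norm X ^+ 2.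
  rewrite sum_trail.
  apply: (@le_trans _ _ (w ^+ 2 * frobenius_norm (X *m delta_mx j' (0 : 'I_1)) ^+ 2)).
    apply: le_trans (spectral_norm_mul _ _).
    rewrite sqr_frobenius_cV le_eqVlt; apply/orP; left; apply/eqP.
    apply: eq_bigr => i _; rewrite /trail_cols trmx_mxsub.
    by rewrite !mul_rowsub_mx -colE [in RHS]mxE.
  rewrite ler_wpM2l ?sqr_ge0//; apply: le_trans (spectral_norm_mul _ _) _.
  rewrite -[delta_mx j' 0]mul1mx -colE frobenius_col_orthonormal ?mulr1//.
  by rewrite /orthonormal_cols trmx1 mul1mx.
(* [T] multiplies coordinate [j] by [s_j^(e+1)]; dividing by [s_j^e] leaves [t s_j] there. Below,
   [y] holds the coordinates of the residual in the columns of [W]. *)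
pose z := (t / s 0 j ^+ e) *: (S *m col j' X).
pose y := \col_i (s 0 j * (i == j)%:R - t / s 0 j ^+ e * s 0 i ^+ e.+1 * c i 0).
have Ey : s 0 j *: col j W - Q *m z = W *m y.
  rewrite -scalemxAr (mulmxA Q) -TQ -!mulmxA (mulmxA V^T) -/c colE !(scalemxAr _ W).
  rewrite -mulmxBr; congr (_ *m _).
  by apply/colP => i; rewrite mul_diag_mx /y; move: (c) => c'; rewrite !mxE andbT; ring.
rewrite -frobeniusZ scalemxAr; apply: le_trans (coproj_dist _ z QQ) _.
rewrite Ey frobenius_orthonormal// sqr_frobenius_cV.
pose g0 := sl ^+ e.+1 / sk ^+ e.
(* Coordinate [j] is [s_j (1 - t)] and the others below [r] vanish. From [r] on, [s_i <= sl] and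
   [s_j >= sk] bound [s_i^(e+1) / s_j^e] by [g0]. *)
have y_le i : y i 0 ^+ 2 <= (if i == j then s1 ^+ 2 * (1 - t) ^+ 2 else 0) +
    (if (r <= i)%N then t ^+ 2 * g0 ^+ 2 * c i 0 ^+ 2 else 0).
  rewrite mxE; case: (leqP r i) => ri.
    have /negPf -> : i != j by apply: contraTneq ri => ->; rewrite -ltnNge.
    have -> : s 0 j * false%:R - t / s 0 j ^+ e * s 0 i ^+ e.+1 * c i 0 =
        - (t * (s 0 i ^+ e.+1 / s 0 j ^+ e) * c i 0).
      by rewrite mulr0 sub0r (mulrAC t) -mulrA.
    rewrite add0r sqrrN 2!exprMn ler_wpM2r ?sqr_ge0// ler_wpM2l ?sqr_ge0//.
    rewrite ler_sqr ?nnegrE.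
    - rewrite ler_pM ?invr_ge0 ?exprn_ge0 ?(ltW sj_gt0)//.
      + by case/andP: (s_bnd i).
      + by rewrite lerXn2r ?nnegrE ?s_trail//; case/andP: (s_bnd i).
      + by rewrite lef_pV2 ?posrE ?exprn_gt0// lerXn2r ?nnegrE ?s_lead
          ?(ltW sk_gt0) ?(ltW sj_gt0).
    - rewrite mulr_ge0 ?invr_ge0 ?exprn_ge0 ?(ltW sj_gt0)//.
      by case/andP: (s_bnd i).
    - by rewrite mulr_ge0 ?invr_ge0 ?exprn_ge0 ?(ltW sk_gt0).
  rewrite c_lead//; case: eqVneq => [->|ij]; last by rewrite !mulr0 subrr expr0n addr0.
  have -> : s 0 j * 1 - t / s 0 j ^+ e * s 0 j ^+ e.+1 * 1 = s 0 j * (1 - t).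
    by rewrite exprS; field; rewrite expf_neq0// gt_eqF.
  rewrite addr0 exprMn ler_wpM2r ?sqr_ge0// ler_sqr ?nnegrE ?(ltW sj_gt0) ?(ltW s1_gt0)//.
  by case/andP: (s_bnd j).
apply: le_trans (ler_sum _ (fun i _ => y_le i)) _.
rewrite big_split /= -!big_mkcond /= big_pred1_eq -mulr_sumr.
apply: (@le_trans _ _ (s1 ^+ 2 * (1 - t) ^+ 2 + t ^+ 2 * g ^+ 2)).
  have -> : g = g0 * (w * spectral_norm X) by rewrite mulrA.
  rewrite lerD2l -mulrA ler_wpM2l ?sqr_ge0// (exprMn _ g0) (exprMn _ w).
  by rewrite ler_wpM2l ?sqr_ge0.
have s1n0 : s1 != 0 by rewrite gt_eqF.
have sgn0 : s1 ^+ 2 + g ^+ 2 != 0.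
  by rewrite gt_eqF// ltr_pwDl ?exprn_gt0// sqr_ge0.
rewrite le_eqVlt; apply/orP; left; apply/eqP; rewrite /t; field.
by rewrite s1n0 sgn0.
Qed.

End ColumnBound.

(** * Frobenius error of the compressed truncation *)

Section TruncationError.
Local Set Implicit Arguments.
Local Unset Strict Implicit.
Context {R : realType} {m n l k : nat}.
Context {A U : 'M[R]_(m, n)} {s : 'rV[R]_n} {V : 'M[R]_n}.
Hypothesis svdA : is_svd A U s V.
Context {Q1 : 'M[R]_(m, l)} {Q2 : 'M[R]_(n, l)}.
Hypotheses (QQ1 : orthonormal_cols Q1) (QQ2 : orthonormal_cols Q2).

Let Ak := svd_trunc k U s V.
Let A0 := A - Ak.

(** The inner product of [A] with [Q1 Y Q2^T] is that of [Q1^T A Q2] with [Y]; then complete the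
    square. Minimising the error over [Y] thus means approximating [Q1^T A Q2]. *)
Lemma frobenius_compress (Y : 'M[R]_l) :
  frobenius_norm (A - Q1 *m Y *m Q2^T) ^+ 2 =
  frobenius_norm A ^+ 2 - frobenius_norm (Q1^T *m A *m Q2) ^+ 2 +
  frobenius_norm (Q1^T *m A *m Q2 - Y) ^+ 2.
Proof.
rewrite !sqr_frobeniusD !frobeniusN !fdotNr.
rewrite frobenius_orthonormal_tr// frobenius_orthonormal//.
by rewrite fdot_mulr fdot_mull trmxK mulmxA; ring.
Qed.

Lemma frobenius_rank_compress (X : 'M[R]_l) Ut st Vt :
  is_svd (Q1^T *m A *m Q2) Ut st Vt -> (\rank X <= k)%N ->
  frobenius_norm (A - Q1 *m svd_trunc k Ut st Vt *m Q2^T) ^+ 2 <=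
  frobenius_norm (A - Q1 *m X *m Q2^T) ^+ 2.
Proof.
move=> svdM rX; rewrite !frobenius_compress lerD2l (frobenius_svd_tail k svdM).
exact: eckart_young svdM rX.
Qed.

(** The nonzero singular values of [A0] have 0-based index at least [k > j]. Allowing every such [j]
    lets each term of a later sum use its own [s_j]. *)
Lemma svd_tail_mul_le (y : 'cV[R]_n) (j : 'I_n) : (j < k)%N ->
  frobenius_norm (A0 *m y) <= s 0 j * frobenius_norm y.
Proof.
case: svdA => UU VV s_ge0 s_noninc AE jk.
rewrite -ler_sqr ?nnegrE ?mulr_ge0 ?s_ge0 ?frobenius_ge0// exprMn.
rewrite /A0 /Ak AE svd_tailE -!mulmxA frobenius_orthonormal//.
have <- : frobenius_norm (V^T *m y) = frobenius_norm y.
  by rewrite frobenius_orthonormal// /orthonormal_cols trmxK (mulmx1C VV).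
rewrite !sqr_frobenius_cV mulr_sumr ler_sum// => i _.
rewrite mul_diag_mx; move: (V^T *m y) => c; rewrite !mxE exprMn.
rewrite ler_wpM2r ?sqr_ge0// ler_sqr ?nnegrE ?s_ge0//; case: ifP => // ki.
by rewrite s_noninc// ltnW// (leq_trans jk).
Qed.

Lemma svd_tail_lead_orthogonal : A0 *m Ak^T = 0 /\ Ak^T *m A0 = 0.
Proof.
case: svdA => UU VV s_ge0 s_noninc AE; rewrite /A0 /Ak AE svd_tailE svd_truncE.
have D0 : diag_mx (tail_row k s) *m diag_mx (lead_row k s) = 0.
  apply/matrixP => i j; rewrite mul_mx_diag !mxE.
  by case: eqVneq => [->|]; rewrite ?mul0r// ltnNge; case: leqP; rewrite ?mulr0 ?mul0r.
rewrite !trmx_mul trmxK tr_diag_mx; split.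
  rewrite -!mulmxA (mulmxA V^T) VV mul1mx (mulmxA (diag_mx _) (diag_mx _)) D0.
  by rewrite mul0mx mulmx0.
rewrite -!mulmxA (mulmxA U^T) UU mul1mx (mulmxA (diag_mx _) (diag_mx _)).
by rewrite diag_mxC D0 mul0mx mulmx0.
Qed.

(** Expand [Ak] into the terms [s_j u_j v_j^T]. In each product one factor [s_j] comes from [Ak],
    the other from [svd_tail_mul_le] applied to [A0]. *)
Lemma svd_trunc_compl_inner :
  - fdot A0 (coproj Q1 *m Ak *m coproj Q2) <=
  \sum_(j < n | (j < k)%N) (s 0 j * frobenius_norm (coproj Q1 *m col j U)) *
                           (s 0 j * frobenius_norm (coproj Q2 *m col j V)).
Proof.
case: (svdA) => UU VV s_ge0 s_noninc AE.
rewrite /Ak svd_truncE !mulmxA -[_ *m V^T *m _]mulmxA.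
rewrite -[V^T *m _]trmxK trmx_mul trmxK coproj_tr mulmx_diag_sum.
rewrite fdot_sumr -sumrN [leRHS]big_mkcond /=; apply: ler_sum => j _.
rewrite fdotZr mxE; case: ifP => jk; last by rewrite mul0r oppr0.
rewrite fdot_mulr trmxK -mulrN -fdotNr -mulrA ler_wpM2l// [leRHS]mulrC.
apply: le_trans (fdot_le _ _) _; rewrite frobeniusN !colE -!mulmxA -!colE.
by rewrite ler_wpM2r ?frobenius_ge0// (svd_tail_mul_le _ jk).
Qed.

Lemma sqr_frobenius_trunc_proj :
  frobenius_norm (A - Q1 *m (Q1^T *m Ak *m Q2) *m Q2^T) ^+ 2 <=
  frobenius_norm A0 ^+ 2 +
  \sum_(j < n | (j < k)%N) (s 0 j * frobenius_norm (coproj Q1 *m col j U) +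
                           s 0 j * frobenius_norm (coproj Q2 *m col j V)) ^+ 2.
Proof.
case: (svdA) => UU VV _ _ AE.
pose E := Ak - Q1 *m (Q1^T *m Ak *m Q2) *m Q2^T.
have -> : A - Q1 *m (Q1^T *m Ak *m Q2) *m Q2^T = A0 + E by rewrite addrA subrK.
set N1 := coproj Q1; set N2 := coproj Q2.
have EE : E = N1 *m Ak + Ak *m N2 - N1 *m Ak *m N2.
  rewrite /E /N1 /N2 /coproj !mulmxA -[in LHS]mulmxA.
  move: (Q1 *m Q1^T) (Q2 *m Q2^T) => P1 P2.
  rewrite !mulmxBl !mulmxBr !mul1mx !mulmx1.
  apply/matrixP => i j; move: (P1 *m Ak *m P2) (P1 *m Ak) (Ak *m P2) => ? ? ?.
  by rewrite !mxE; ring.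
have [A0Ak AkA0] := svd_tail_lead_orthogonal.
have A0E : fdot A0 E = - fdot A0 (N1 *m Ak *m N2).
  rewrite EE fdotBr fdotDr fdot_mulr A0Ak fdot_mull AkA0.
  by rewrite !(fdotC 0) !fdot0r !add0r.
(* Pythagoras along [P1 = Q1 Q1^T] and [N1]: here [N1 E = N1 Ak] and [P1 E = P1 Ak N2]. *)
have normE : frobenius_norm E ^+ 2 <=
    frobenius_norm (N1 *m Ak) ^+ 2 + frobenius_norm (Ak *m N2) ^+ 2.
  rewrite (sqr_frobenius_proj _ (rangeproj_tr Q1) (rangeproj_idem QQ1)) addrC.
  have PN : Q1 *m Q1^T *m N1 = 0.
    by rewrite mulmxBr mulmx1 rangeproj_idem// subrr.
  rewrite -/(coproj Q1) -/N1 {1}EE mulmxBr mulmxDr !mulmxA coproj_idem//.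
  rewrite -/N1 addrK lerD2l EE mulmxBr mulmxDr !mulmxA PN !mul0mx add0r subr0.
  by rewrite -mulmxA frobenius_proj_le ?rangeproj_tr ?rangeproj_idem.
have leadE a (X : 'M[R]_(a, n)) : frobenius_norm (X *m diag_mx (lead_row k s)) ^+ 2 =
    \sum_(j < n | (j < k)%N) s 0 j ^+ 2 * frobenius_norm (col j X) ^+ 2.
  rewrite frobenius_mul_diag [RHS]big_mkcond; apply: eq_bigr => j _.
  by rewrite mxE; case: ifP => _; rewrite // expr0n mul0r.
have norm1 : frobenius_norm (N1 *m Ak) ^+ 2 =
    \sum_(j < n | (j < k)%N) s 0 j ^+ 2 * frobenius_norm (N1 *m col j U) ^+ 2.
  rewrite /Ak svd_truncE !mulmxA frobenius_orthonormal_tr// leadE.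
  by apply: eq_bigr => j _; rewrite !colE mulmxA.
have norm2 : frobenius_norm (Ak *m N2) ^+ 2 =
    \sum_(j < n | (j < k)%N) s 0 j ^+ 2 * frobenius_norm (N2 *m col j V) ^+ 2.
  rewrite /Ak svd_truncE -!mulmxA frobenius_orthonormal// -frobenius_tr.
  rewrite !trmx_mul trmxK tr_diag_mx coproj_tr leadE.
  by apply: eq_bigr => j _; rewrite !colE mulmxA.
(* Twice the inner product and the two squares in [normE] combine, for each [j], into the square of
   a sum. *)
rewrite sqr_frobeniusD A0E -addrA lerD2l.
apply: le_trans (lerD (ler_wMn2r 2 svd_trunc_compl_inner) normE) _.
rewrite norm1 norm2 -sumrMnl -!big_split /= le_eqVlt; apply/orP; left; apply/eqP.
by apply: eq_bigr => j _; ring.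
Qed.

(** The competitor in [frobenius_rank_compress] is [Q1^T Ak Q2], and at most [k] indices contribute
    to the resulting sum. *)
Lemma sqr_frobenius_trunc_error Ut st Vt (x1 x2 : R) :
  is_svd (Q1^T *m A *m Q2) Ut st Vt -> 0 <= x1 -> 0 <= x2 ->
  (forall j : 'I_n, (j < k)%N ->
    s 0 j ^+ 2 * frobenius_norm (coproj Q1 *m col j U) ^+ 2 <= x1 ^+ 2) ->
  (forall j : 'I_n, (j < k)%N ->
    s 0 j ^+ 2 * frobenius_norm (coproj Q2 *m col j V) ^+ 2 <= x2 ^+ 2) ->
  frobenius_norm (A - Q1 *m svd_trunc k Ut st Vt *m Q2^T) ^+ 2 <=
  frobenius_norm A0 ^+ 2 + k%:R * (x1 + x2) ^+ 2.
Proof.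
move=> svdM x1_ge0 x2_ge0 le1 le2.
have rX : (\rank (Q1^T *m Ak *m Q2) <= k)%N.
  apply: leq_trans (mxrankM_maxl _ _) (leq_trans (mxrankM_maxr _ _) _).
  exact: mxrank_svd_trunc.
apply: le_trans (frobenius_rank_compress svdM rX) _.
apply: le_trans sqr_frobenius_trunc_proj _; rewrite lerD2l.
apply: (@le_trans _ _ (\sum_(j < n | (j < k)%N) (x1 + x2) ^+ 2)); last first.
  rewrite sumr_const -[leLHS]mulr_natl ler_wpM2r ?sqr_ge0// ler_nat.
  by rewrite -sum1_card sum_ltn_ord.
have s_ge0 : forall i, 0 <= s 0 i by case: svdA.
have le_x (a b : R) : 0 <= a -> 0 <= b -> a ^+ 2 <= b ^+ 2 -> a <= b.
  by move=> a0 b0; rewrite ler_sqr.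
apply: ler_sum => j jk; rewrite ler_sqr ?nnegrE ?addr_ge0 ?mulr_ge0 ?frobenius_ge0//.
rewrite lerD// le_x ?mulr_ge0 ?frobenius_ge0// exprMn; [exact: le1|exact: le2].
Qed.

End TruncationError.

(** * From near-optimal Frobenius error to either norm *)

Section MatrixNorms.
Local Set Implicit Arguments.
Local Unset Strict Implicit.
Context {R : realType}.
Implicit Types m n k : nat.

Lemma mxrank_outer m n (y : 'cV[R]_m) (x : 'cV[R]_n) : (\rank (y *m x^T) <= 1)%N.
Proof. exact: leq_trans (mxrankM_maxl _ _) (rank_leq_col _). Qed.

(** Expanding gives [|D - D x x^T|^2 = |D|^2 - (2 - |x|^2) |D x|^2], and [|x| <= 1]. *)
Lemma sqr_frobenius_deflate m n (D : 'M[R]_(m, n)) (x : 'cV[R]_n) :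
  frobenius_norm x <= 1 ->
  frobenius_norm (D *m x) ^+ 2 + frobenius_norm (D - D *m x *m x^T) ^+ 2 <=
  frobenius_norm D ^+ 2.
Proof.
move=> x1; have xx : x^T *m x = (frobenius_norm x ^+ 2)%:M.
  by rewrite [LHS]mx11_scalar sqr_frobenius /fdot trace_mx11.
rewrite sqr_frobeniusD frobeniusN fdotNr fdot_mulr trmxK -sqr_frobenius.
rewrite [X in _ + (_ + X)]sqr_frobenius fdot_mulr trmxK -[D *m x *m _ *m x]mulmxA xx.
rewrite mul_mx_scalar fdotC fdotZr -sqr_frobenius.
have : frobenius_norm x ^+ 2 <= 1 by rewrite exprn_ile1 ?frobenius_ge0.
have := sqr_ge0 (frobenius_norm (D *m x)).
by move: (frobenius_norm (D *m x) ^+ 2) (frobenius_norm x ^+ 2) => a b; nra.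
Qed.

(* In the spectral case, deflating one direction [x] from the error leaves an
   approximation of rank at most [k + 1], so that [|(A - B) x|^2] is at most
   [|A - B|_F^2] minus the tail of the singular values after the [k + 1]st. *)
Lemma mxnorm_trunc_error rho m n k (A B U : 'M[R]_(m, n)) s V (c : R) :
  is_svd A U s V -> (k < n)%N -> (\rank B <= k)%N -> 0 <= c ->
  frobenius_norm (A - B) ^+ 2 <=
    frobenius_norm (A - svd_trunc k U s V) ^+ 2 + c ^+ 2 ->
  mxnorm rho (A - B) <= mxnorm rho (A - svd_trunc k U s V) + c.
Proof.
move=> svdA kn rB c_ge0 errF.
have le_add (a b : R) : 0 <= a -> 0 <= b -> a ^+ 2 <= b ^+ 2 + c ^+ 2 -> a <= b + c.
  move=> a_ge0 b_ge0 h; rewrite -ler_sqr ?nnegrE ?addr_ge0//.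
  by apply: le_trans h _; rewrite sqrrD; have := mulr_ge0 b_ge0 c_ge0; lra.
case: rho => /=; last by rewrite le_add ?frobenius_ge0.
apply: spectral_norm_le => x x1.
apply: le_add; rewrite ?frobenius_ge0 ?spectral_norm_ge0//.
pose i0 := Ordinal kn; case: (svdA) => UU VV s_ge0 s_noninc AE.
(* [s 0 i0] is the singular value number [k + 1]; testing the tail on [col i0 V] shows that it is at
   most the spectral norm of the tail. *)
apply: (@le_trans _ _ (s 0 i0 ^+ 2 + c ^+ 2)); last first.
  rewrite lerD2r ler_sqr ?nnegrE ?s_ge0 ?spectral_norm_ge0//.
  have := @spectral_norm_ub _ _ _ (A - svd_trunc k U s V) (col i0 V).
  have n1 p q (W : 'M[R]_(p, q)) j : orthonormal_cols W -> frobenius_norm (col j W) = 1.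
    move=> WW; apply/eqP; rewrite -(eqrXn2 (ltn0Sn 1)) ?frobenius_ge0//.
    by rewrite frobenius_col_orthonormal ?expr1n.
  rewrite n1// => /(_ (lexx _)); apply: le_trans.
  rewrite AE svd_tailE colE -!mulmxA (mulmxA V^T) VV mul1mx frobenius_orthonormal//.
  rewrite -ler_sqr ?nnegrE ?s_ge0 ?frobenius_ge0// sqr_frobenius_cV.
  rewrite (bigD1 i0)//= mul_diag_mx !mxE leqnn !eqxx mulr1 lerDl.
  by rewrite sumr_ge0// => i _; rewrite sqr_ge0.
have rB' : (\rank (B + (A - B) *m x *m x^T)%R <= k.+1)%N.
  by apply: leq_trans (mxrank_add _ _) _; rewrite -(addn1 k) leq_add// mxrank_outer.
have := eckart_young svdA rB'; rewrite opprD addrA => tail.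
have := sqr_frobenius_deflate (A - B) x1.
move: errF; rewrite (frobenius_svd_tail k svdA).
(* Splitting [i0] off leaves exactly the sum in [tail]; it cancels, and [s 0 i0 ^+ 2] remains. *)
rewrite (bigD1 i0)//= (eq_bigl (fun i : 'I_n => (k < i)%N)); last first.
  by move=> i; rewrite [RHS]ltn_neqAle andbC eq_sym.
by lra.
Qed.

End MatrixNorms.

(** * Power iterates in terms of the SVD *)

Section PowerIterates.
Local Set Implicit Arguments.
Local Unset Strict Implicit.
Context {R : realType}.

Lemma sigma_ord n (s : 'rV[R]_n) (i : 'I_n) : sigma s i.+1 = s 0 i.
Proof. by rewrite /sigma /= valK. Qed.

(** In the Penrose equation [B X B = B], full row rank allows cancelling [B] on the right. *)
Lemma mulmx_moore_penrose m n (B : 'M[R]_(m, n)) :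
  row_free B -> B *m moore_penrose B = 1%:M.
Proof.
move=> fB; have [BXB _ _ _] := moore_penroseP B.
by apply: (row_free_inj fB); rewrite BXB mul1mx.
Qed.

Lemma diag_mx_expr n (s : 'rV[R]_n) e :
  diag_mx (\row_i s 0 i ^+ e.+1) = diag_mx s *m diag_mx (\row_i s 0 i ^+ e).
Proof.
by apply/matrixP => i j; rewrite mul_diag_mx !mxE; case: eqP => _;
  rewrite ?mulr0// !mulr1n exprS.
Qed.

(** Each factor [A A^T] adds two to the exponent, since the inner orthonormal factors cancel. *)
Lemma power_iterate m n q (A U : 'M[R]_(m, n)) s V :
  is_svd A U s V ->
  (A *m A^T) ^+ q *m A = U *m diag_mx (\row_i s 0 i ^+ (2 * q).+1) *m V^T.
Proof.
case=> UU VV _ _ AE; elim: q => [|q IH].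
  rewrite expr0 mul1mx AE; congr (_ *m diag_mx _ *m _).
  by apply/rowP => i; rewrite mxE.
rewrite exprS -[_ * _]/(_ *m _) -mulmxA IH mulnS add2n !diag_mx_expr AE.
rewrite !trmx_mul trmxK tr_diag_mx -!mulmxA.
by rewrite (mulmxA V^T V) VV mul1mx (mulmxA U^T U) UU mul1mx.
Qed.

Lemma power_iterate_tr m n q (A U : 'M[R]_(m, n)) s V :
  is_svd A U s V ->
  A^T *m ((A *m A^T) ^+ q *m A) =
    V *m diag_mx (\row_i s 0 i ^+ (2 * q).+2) *m V^T.
Proof.
move=> svdA; rewrite (power_iterate q svdA); case: svdA => UU VV _ _ AE.
rewrite [in RHS]diag_mx_expr AE !trmx_mul trmxK tr_diag_mx -!mulmxA.
by rewrite (mulmxA U^T U) UU mul1mx.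
Qed.

End PowerIterates.

(** * The error bound for both variants of the algorithm *)

Theorem theorem5 (R : realType) (m n k l p : nat)
    (A : 'M[R]_(m, n)) (U : 'M[R]_(m, n)) (s : 'rV[R]_n) (V : 'M[R]_n)
    (Omega : 'M[R]_(n, l))
    (le_nm : (n <= m)%N) (lt_kn : (maxn k 2 < n)%N)
    (le_kl : (k <= l)%N) (lt_ln : (l < n)%N)
    (k_ge1 : (1 <= k)%N) (pk_ge2 : (2 <= p + k)%N) (pk_le_l : (p + k <= l)%N)
    (svdA : is_svd A U s V) (sigma_k_gt0 : 0 < sigma s k) :
  let A0 := A - svd_trunc k U s V in
  let V1 := lead_cols (leq_trans (leq_subr p l) (ltnW lt_ln)) V in
  let V2 := trail_cols (l - p) V in
  let Omega1 := V1^T *m Omega in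
  let Omega2 := V2^T *m Omega in
  let w := spectral_norm Omega2 in
  let d := spectral_norm (moore_penrose Omega1) in
  let s1 := sigma s 1 in
  let sk := sigma s k in
  let slp1 := sigma s (l - p + 1) in
  let bound rho alpha beta eta tau :=
    mxnorm rho A0
    + Num.sqrt (alpha ^+ 2 * w ^+ 2 * d ^+ 2 / (1 + beta ^+ 2 * w ^+ 2 * d ^+ 2))
    + Num.sqrt (eta ^+ 2 * w ^+ 2 * d ^+ 2 / (1 + tau ^+ 2 * w ^+ 2 * d ^+ 2)) in
  row_free Omega1 ->
  forall rho : norm_kind,
  (forall Ahat : 'M[R]_(m, n), sor_svd k A Omega Ahat ->
     let alpha := Num.sqrt k%:R * (slp1 ^+ 2 / sk) in
     let beta := slp1 ^+ 2 / (s1 * sk) in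
     let eta := Num.sqrt k%:R * slp1 in
     let tau := slp1 / s1 in
     mxnorm rho (A - Ahat) <= bound rho alpha beta eta tau)
  /\
  (forall (q : nat) (Ahat : 'M[R]_(m, n)), sor_svd_power q k A Omega Ahat ->
     let alpha := Num.sqrt k%:R * (slp1 ^+ 2 / sk) * (slp1 / sk) ^+ (2 * q) in
     let beta := slp1 ^+ 2 / (s1 * sk) * (slp1 / sk) ^+ (2 * q) in
     let eta := Num.sqrt k%:R * slp1 * (slp1 / sk) ^+ (2 * q) in
     let tau := slp1 / s1 * (slp1 / sk) ^+ (2 * q) in
     mxnorm rho (A - Ahat) <= bound rho alpha beta eta tau).
Proof.
move=> A0 V1 V2 Omega1 Omega2 w d s1 sk slp1 bound free1 rho.
(* The basic algorithm is the power method with [q = 0]. *)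
suff power q Ahat : sor_svd_power q k A Omega Ahat ->
    mxnorm rho (A - Ahat) <=
    bound rho (Num.sqrt k%:R * (slp1 ^+ 2 / sk) * (slp1 / sk) ^+ (2 * q))
      (slp1 ^+ 2 / (s1 * sk) * (slp1 / sk) ^+ (2 * q))
      (Num.sqrt k%:R * slp1 * (slp1 / sk) ^+ (2 * q))
      (slp1 / s1 * (slp1 / sk) ^+ (2 * q)).
  split=> [Ahat run|q Ahat run]; last exact: power run.
  have := power 0 Ahat; rewrite muln0 expr0 !mulr1; apply.
  by rewrite /sor_svd_power expr0 mul1mx.
rewrite /sor_svd_power => -[Q1 [S1 [Q2 [S2 [Ut [st [Vt []]]]]]]].
case=> QQ1 _ TQ1 [QQ2 _ TQ2] svdM ->.
have [UU VV s_ge0 s_noninc AE] := svdA.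
set r := (l - p)%N in slp1 V1 V2 Omega1 Omega2 w d bound free1 |- *.
have kr : (k <= r)%N by rewrite /r; lia.
have rn : (r < n)%N by rewrite /r; lia.
have kn : (k < n)%N by lia.
have n_gt0 : (0 < n)%N by lia.
have sigmaE i (lt_in : (i < n)%N) : sigma s i.+1 = s 0 (Ordinal lt_in).
  by rewrite -sigma_ord.
have s1E : s1 = s 0 (Ordinal n_gt0) by rewrite -sigmaE.
have km1 : (k.-1 < n)%N by lia.
have skE : sk = s 0 (Ordinal km1) by rewrite -sigmaE prednK.
(* The 1-based index [l - p + 1] is the 0-based index [r], the first one in the trailing block. *)
have slE : slp1 = s 0 (Ordinal rn) by rewrite -sigmaE /slp1 addn1.
have s_bnd i : 0 <= s 0 i <= s1 by rewrite s_ge0 s1E s_noninc.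
have s_lead (i : 'I_n) : (i < k)%N -> sk <= s 0 i.
  by move=> ik; rewrite skE s_noninc//=; lia.
have s_trail (i : 'I_n) : (r <= i)%N -> s 0 i <= slp1.
  by move=> ri; rewrite slE s_noninc.
have sl_ge0 : 0 <= slp1 by rewrite slE.
have sk_neq0 : sk != 0 by rewrite gt_eqF.
have s1_neq0 : s1 != 0.
  by rewrite gt_eqF// (lt_le_trans sigma_k_gt0)// -/sk skE s1E s_noninc.
have OmX := mulmx_moore_penrose free1.
pose g e := slp1 ^+ e.+1 / sk ^+ e * w * d.
pose x e := Num.sqrt (g e ^+ 2 / (1 + (g e / s1) ^+ 2)).
have xE e : x e ^+ 2 = g e ^+ 2 / (1 + (g e / s1) ^+ 2).
  by rewrite sqr_sqrtr// divr_ge0 ?addr_ge0 ?sqr_ge0.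
have le1 := subspace_col_bound (e := (2 * q)%N) UU QQ1 s_bnd sigma_k_gt0 s_lead s_trail
  kr sl_ge0 OmX.
have le2 := subspace_col_bound (e := (2 * q).+1%N) VV QQ2 s_bnd sigma_k_gt0 s_lead
  s_trail kr sl_ge0 OmX.
(* Both square roots have one shape: [e = 2q + 1], from [T2], gives [alpha] and [beta]; [e = 2q],
   from [T1], gives [eta] and [tau]. *)
have sqrtE al be e : al = Num.sqrt k%:R * (slp1 ^+ e.+1 / sk ^+ e) ->
    be = slp1 ^+ e.+1 / sk ^+ e / s1 ->
    Num.sqrt (al ^+ 2 * w ^+ 2 * d ^+ 2 / (1 + be ^+ 2 * w ^+ 2 * d ^+ 2)) =
    Num.sqrt k%:R * x e.
  move=> -> ->; rewrite /x -sqrtrM ?ler0n//; congr Num.sqrt.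
  rewrite (exprMn _ (Num.sqrt _)) sqr_sqrtr ?ler0n// /g [RHS]mulrA.
  move: (slp1 ^+ e.+1 / sk ^+ e) => y.
  by congr (_ / (1 + _)); rewrite ?exprMn; ring.
have skX_neq0 e : sk ^+ e != 0 by rewrite expf_neq0.
rewrite /bound (sqrtE _ _ (2 * q).+1%N) ?(sqrtE _ _ (2 * q)%N).
2-5: by rewrite expr_div_n !exprS; field; rewrite ?sk_neq0 ?s1_neq0 skX_neq0.
rewrite -addrA -mulrDr.
apply: (mxnorm_trunc_error rho svdA kn).
- apply: leq_trans (mxrankM_maxl _ _) (leq_trans (mxrankM_maxr _ _) _).
  exact: mxrank_svd_trunc.
- by rewrite mulr_ge0 ?addr_ge0 ?sqrtr_ge0.
(* The added error is [sqrt k] times the sum of the two [x e], so its square is the [k (x1 + x2)^2]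
   of [sqr_frobenius_trunc_error], once the [T1] term is put first. *)
rewrite exprMn (sqr_sqrtr (ler0n _ k)) [x _ + _]addrC.
apply: (sqr_frobenius_trunc_error svdA QQ1 QQ2 svdM);
  rewrite ?sqrtr_ge0// => j jk; rewrite xE.
- apply: (le1 _ _ _ jk); rewrite -(power_iterate q svdA); exact: TQ1.
- apply: (le2 _ _ _ jk); rewrite -(power_iterate_tr q svdA) -[LHS]mulmxA; exact: TQ2.
Qed.
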